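(* Let $\mathrm{F}$ be one of the functors $\mathrm{Spec}$, $\mathrm{Max}$, $\mathrm{R\text{-}Max}$, $\mathrm{R\text{-}Spec}$. Let $A\hookrightarrow C\hookrightarrow B$ be integral extensions of rings. Then the following statements are equivalent: 1) The extension $A \hookrightarrow C$ is $\mathrm{F}$-subintegral. 2) The image of $C\hookrightarrow B$ is a subring of $A_B^{\mathrm{F}}$.
   Context: Rings are commutative with unit. An ideal $I$ of a ring $A$ is real if $\sum a_i^2\in I$ (finite sum) implies that every $a_i\in I$. $\mathrm{R\text{-}Spec}(A)$ (resp. $\mathrm{R\text{-}Max}(A)$) is the set of real prime (resp. real maximal) ideals of $A$. For an integral extension $A\hookrightarrow B$ put $A_B^{\mathrm{F}}=\{b\in B\mid \forall \mathfrak{p}\in\mathrm{F}(A),\ b_{\mathfrak p}\in A_{\mathfrak p}+\mathrm{Rad}(B_{\mathfrak p})\}$, where $B_{\mathfrak p}=(A\setminus\mathfrak p)^{-1}B$, $b_{\mathfrak p}$ is the image of $b$ in $B_{\mathfrak p}$, and $\mathrm{Rad}$ is the Jacobson radical. An integral extension $A\hookrightarrow B$ is $\mathrm{F}$-subintegral if for all $\mathfrak p\in\mathrm{F}(A)$ there exists a unique $\mathfrak q\in\mathrm{Spec}(B)$ with $\mathfrak q\cap A=\mathfrak p$, and for such $\mathfrak p,\mathfrak q$ one has $\mathfrak q\in\mathrm{F}(B)$ and the induced map of residue fields $\kappa(\mathfrak p)\hookrightarrow\kappa(\mathfrak q)$ is an isomorphism. *)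

(* Defs.v *)
From HB Require Import structures.
From mathcomp Require Import all_boot all_order all_algebra.
From mathcomp Require Import generic_quotient ring_quotient.
From mathcomp Require Import boolp classical_sets.
From mathcomp Require Import ring.

Set Implicit Arguments.
Unset Strict Implicit.
Unset Printing Implicit Defensive.

Import GRing.Theory.
Local Open Scope ring_scope.
Local Open Scope quotient_scope.
Local Open Scope classical_set_scope.

(* Rings are [comPzRingType]s, so that the zero ring is allowed.  MathComp's
   [prime_idealr] and [integralOver] are restricted to nonzero rings; the
   notions below are their analogues without that restriction. *)

Section Ideals.
Variable A : comPzRingType.
Implicit Types I J : set A.

Definition ideal I : Prop :=
  [/\ I 0, forall x y, I x -> I y -> I (x + y) & forall a x, I x -> I (a * x)].

Definition prime_ideal I : Prop :=
  [/\ ideal I, ~ I 1 & forall x y, I (x * y) -> I x \/ I y].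

Definition maximal_ideal I : Prop :=
  [/\ ideal I, ~ I 1 & forall J, ideal J -> I `<=` J -> ~ J 1 -> J = I].

Definition real_ideal I : Prop :=
  ideal I /\
  forall s : seq A, I (\sum_(a <- s) a ^+ 2) -> forall a, a \in s -> I a.

Definition jacobson : set A := \bigcap_(M in maximal_ideal) M.

Definition is_subring (S : set A) : Prop :=
  [/\ S 1, forall x y, S x -> S y -> S (x - y)
         & forall x y, S x -> S y -> S (x * y)].

Definition subring_of (S T : set A) : Prop := is_subring S /\ S `<=` T.

End Ideals.

Arguments jacobson : clear implicits.

Record primeIdeal (A : comPzRingType) := PrimeIdeal {
  prime_set :> set A;
  prime_setP : prime_ideal prime_set
}.

Variant spec_functor := Spec | Max | RMax | RSpec.

(* Maximal ideals are prime (lemma [maximal_prime] below), so Max and R-Max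
   can be taken inside the type of prime ideals. *)
Definition fspec (F : spec_functor) (A : comPzRingType) : set (primeIdeal A) :=
  match F with
  | Spec => setT
  | Max => [set p | maximal_ideal p]
  | RMax => [set p | real_ideal p /\ maximal_ideal p]
  | RSpec => [set p | real_ideal p]
  end.

Section IdealLemmas.
Variable A : comPzRingType.

Lemma ideal_opp (I : set A) x : ideal I -> I x -> I (- x).
Proof. by case=> _ _ IM Ix; rewrite -mulN1r; apply: IM. Qed.

Lemma ideal_sub (I : set A) x y : ideal I -> I x -> I y -> I (x - y).
Proof. by move=> II Ix Iy; case: (II) => _ ID _; apply: ID => //; exact: ideal_opp. Qed.

Lemma maximal_prime (I : set A) : maximal_ideal I -> prime_ideal I.
Proof.
move=> [idI I1 Imax]; split=> // x y Ixy; apply: contrapT => /not_orP [nx ny].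
have [I0 ID IM] := idI.
pose J := [set z | exists a b, I a /\ z = a + b * x].
have idJ : ideal J.
  split.
  - by exists 0, 0; rewrite mul0r addr0.
  - move=> _ _ [a [b [Ia ->]]] [c [d [Ic ->]]]; exists (a + c), (b + d).
    by split; [exact: ID | rewrite mulrDl addrACA].
  - move=> c _ [a [b [Ia ->]]]; exists (c * a), (c * b).
    by split; [exact: IM | rewrite mulrDr mulrA].
have IJ : I `<=` J by move=> z Iz; exists z, 0; rewrite mul0r addr0.
have Jx : J x by exists 0, 1; rewrite mul1r add0r.
case: (pselect (J 1)) => [[a [b [Ia e]]]|J1]; last first.
  by apply: nx; rewrite -(Imax _ idJ IJ J1).
apply: ny; rewrite -[y]mul1r e mulrDl; apply: ID; first by rewrite mulrC; apply: IM.
by rewrite -mulrA; apply: IM.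
Qed.

Lemma jacobson_ideal : ideal (jacobson A).
Proof.
split=> [|x y Jx Jy|a x Jx] M mM; have [[I0 ID IM] _ _] := mM.
- exact: I0.
- by apply: ID; [exact: Jx | exact: Jy].
- by apply: IM; exact: Jx.
Qed.

End IdealLemmas.

Section Localization.
Variables (A : comPzRingType) (S : mulrClosed A).

Record fraction_pair := FractionPair {
  num_den :> A * A;
  denP : num_den.2 \in S
}.

HB.instance Definition _ := [isSub for num_den].
HB.instance Definition _ := [Choice of fraction_pair by <:].

Implicit Types x y z : fraction_pair.

Definition mkpair (a s : A) (sS : s \in S) : fraction_pair :=
  @FractionPair (a, s) sS.

(* a/s = b/t iff u (a t - b s) = 0 for some u in S; the factor u is needed
   since S may contain zero divisors. *)
Definition loc_equiv x y : bool :=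
  `[< exists2 u, u \in S & u * (x.1 * y.2) = u * (y.1 * x.2) >].

Lemma loc_equiv_is_equiv : equiv_class_of loc_equiv.
Proof.
split=> [x|x y|y x z].
- by apply/asboolP; exists 1; rewrite ?rpred1.
- by apply/asboolP/asboolP => -[u uS e]; exists u.
- move=> /asboolP[u uS e] /asboolP[v vS e']; apply/asboolP.
  exists (u * v * y.2); first by rewrite !rpredM ?denP.
  transitivity (u * (x.1 * y.2) * (v * z.2)); first by ring.
  rewrite e.
  transitivity (v * (y.1 * z.2) * (u * x.2)); first by ring.
  by rewrite e'; ring.
Qed.

Canonical loc_equiv_equiv := EquivRelPack loc_equiv_is_equiv.
Canonical loc_equiv_encModRel := defaultEncModRel loc_equiv.

Definition loc := {eq_quot loc_equiv}.

HB.instance Definition _ : EqQuotient fraction_pair loc_equiv loc :=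
  EqQuotient.on loc.
HB.instance Definition _ := Choice.on loc.


Lemma eq_locP x y :
  reflect (exists2 u, u \in S & u * (x.1 * y.2) = u * (y.1 * x.2))
          (x == y %[mod loc]).
Proof. by rewrite eqmodE; apply: asboolP. Qed.

Lemma locP x y : (exists2 u, u \in S & u * (x.1 * y.2) = u * (y.1 * x.2)) ->
  \pi_loc x = \pi_loc y.
Proof. by move=> h; apply/eqP/eq_locP. Qed.

Lemma loc_reprP x :
  exists2 u, u \in S & u * ((repr (\pi_loc x)).1 * x.2)
                     = u * (x.1 * (repr (\pi_loc x)).2).
Proof. by apply/eq_locP; rewrite reprK. Qed.

Definition pair_add x y : fraction_pair :=
  mkpair (x.1 * y.2 + y.1 * x.2) (rpredM (denP x) (denP y)).
Definition pair_opp x : fraction_pair := mkpair (- x.1) (denP x).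
Definition pair_mul x y : fraction_pair :=
  mkpair (x.1 * y.1) (rpredM (denP x) (denP y)).

Definition loc0 : loc := lift_cst loc (mkpair 0 (rpred1 S)).
Definition loc1 : loc := lift_cst loc (mkpair 1 (rpred1 S)).
Definition loc_add := lift_op2 loc pair_add.
Definition loc_opp := lift_op1 loc pair_opp.
Definition loc_mul := lift_op2 loc pair_mul.

Canonical pi_loc0_morph := PiConst loc0.
Canonical pi_loc1_morph := PiConst loc1.

Lemma pi_loc_add : {morph \pi : x y / pair_add x y >-> loc_add x y}.
Proof.
move=> x y; unlock loc_add; apply: locP => /=.
have [u uS e] := loc_reprP x; have [v vS e'] := loc_reprP y.
exists (u * v); first exact: rpredM.
move: (repr (\pi_loc x)) (repr (\pi_loc y)) e e' => x' y' e e'.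
transitivity (u * (x.1 * x'.2) * (v * y'.2 * y.2)
  + v * (y.1 * y'.2) * (u * x'.2 * x.2)); first by ring.
by rewrite -e -e'; ring.
Qed.
Canonical pi_loc_add_morph := PiMorph2 pi_loc_add.

Lemma pi_loc_opp : {morph \pi : x / pair_opp x >-> loc_opp x}.
Proof.
move=> x; unlock loc_opp; apply: locP => /=.
have [u uS e] := loc_reprP x; exists u => //.
by rewrite !mulNr !mulrN e.
Qed.
Canonical pi_loc_opp_morph := PiMorph1 pi_loc_opp.

Lemma pi_loc_mul : {morph \pi : x y / pair_mul x y >-> loc_mul x y}.
Proof.
move=> x y; unlock loc_mul; apply: locP => /=.
have [u uS e] := loc_reprP x; have [v vS e'] := loc_reprP y.
exists (u * v); first exact: rpredM.
move: (repr (\pi_loc x)) (repr (\pi_loc y)) e e' => x' y' e e'.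
transitivity (u * (x.1 * x'.2) * (v * (y.1 * y'.2))); first by ring.
by rewrite -e -e'; ring.
Qed.
Canonical pi_loc_mul_morph := PiMorph2 pi_loc_mul.

Lemma loc_eq1 x y : x.1 * y.2 = y.1 * x.2 -> \pi_loc x = \pi_loc y.
Proof. by move=> e; apply: locP; exists 1; rewrite ?rpred1 ?e. Qed.

Lemma loc_addA : associative loc_add.
Proof.
by elim/quotW=> x; elim/quotW=> y; elim/quotW=> z; rewrite !piE;
   apply: loc_eq1 => /=; ring.
Qed.

Lemma loc_addC : commutative loc_add.
Proof. by elim/quotW=> x; elim/quotW=> y; rewrite !piE; apply: loc_eq1 => /=; ring. Qed.

Lemma loc_add0 : left_id loc0 loc_add.
Proof. by elim/quotW=> x; rewrite !piE; apply: loc_eq1 => /=; ring. Qed.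

Lemma loc_addN : left_inverse loc0 loc_opp loc_add.
Proof. by elim/quotW=> x; rewrite !piE; apply: loc_eq1 => /=; ring. Qed.

HB.instance Definition _ :=
  GRing.isZmodule.Build loc loc_addA loc_addC loc_add0 loc_addN.

Lemma loc_mulA : associative loc_mul.
Proof.
by elim/quotW=> x; elim/quotW=> y; elim/quotW=> z; rewrite !piE;
   apply: loc_eq1 => /=; ring.
Qed.

Lemma loc_mulC : commutative loc_mul.
Proof. by elim/quotW=> x; elim/quotW=> y; rewrite !piE; apply: loc_eq1 => /=; ring. Qed.

Lemma loc_mul1 : left_id loc1 loc_mul.
Proof. by elim/quotW=> x; rewrite !piE; apply: loc_eq1 => /=; ring. Qed.

Lemma loc_mulD : left_distributive loc_mul loc_add.
Proof.
by elim/quotW=> x; elim/quotW=> y; elim/quotW=> z; rewrite !piE;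
   apply: loc_eq1 => /=; ring.
Qed.

HB.instance Definition _ :=
  GRing.Zmodule_isComPzRing.Build loc loc_mulA loc_mulC loc_mul1 loc_mulD.

Definition frac (a s : A) (sS : s \in S) : loc := \pi_loc (mkpair a sS).

Lemma fracP (z : loc) : exists a s (sS : s \in S), z = frac a sS.
Proof.
by elim/quotW: z => -[[a s] sS]; exists a, s, sS.
Qed.

Lemma eq_frac (a b s t : A) (sS : s \in S) (tS : t \in S) :
  frac a sS = frac b tS <-> exists2 u, u \in S & u * (a * t) = u * (b * s).
Proof. by split=> [/eqP/eq_locP|?]; [|apply/eqP/eq_locP]. Qed.

Lemma fracD (a b s t : A) (sS : s \in S) (tS : t \in S) :
  frac a sS + frac b tS = frac (a * t + b * s) (rpredM sS tS).
Proof. by rewrite /frac -[LHS]pi_loc_add; apply: loc_eq1. Qed.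

Lemma fracN (a s : A) (sS : s \in S) : - frac a sS = frac (- a) sS.
Proof. by rewrite /frac -[LHS]pi_loc_opp; apply: loc_eq1. Qed.

Lemma fracM (a b s t : A) (sS : s \in S) (tS : t \in S) :
  frac a sS * frac b tS = frac (a * b) (rpredM sS tS).
Proof. by rewrite /frac -[LHS]pi_loc_mul; apply: loc_eq1. Qed.

Lemma frac0 : frac 0 (rpred1 S) = 0. Proof. by rewrite /frac !piE. Qed.

Lemma frac1 : frac 1 (rpred1 S) = 1. Proof. by rewrite /frac !piE. Qed.

Definition to_loc (a : A) : loc := frac a (rpred1 S).

Lemma to_loc_zmod : zmod_morphism to_loc.
Proof.
move=> a b; rewrite /to_loc fracN fracD.
by apply/eq_frac; exists 1; [exact: rpred1 | ring].
Qed.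

Lemma to_loc_monoid : monoid_morphism to_loc.
Proof.
split=> [|a b]; first exact: frac1.
by rewrite /to_loc fracM; apply/eq_frac; exists 1; [exact: rpred1 | ring].
Qed.

HB.instance Definition _ := GRing.isZmodMorphism.Build A loc to_loc to_loc_zmod.
HB.instance Definition _ :=
  GRing.isMonoidMorphism.Build A loc to_loc to_loc_monoid.

End Localization.

(* The homomorphism S^-1 A -> T^-1 B, a/s |-> f(a)/f(s), for f(S) included
   in T. *)
Section LocMap.
Variables (A B : comPzRingType) (f : {rmorphism A -> B}).
Variables (S : mulrClosed A) (T : mulrClosed B).
Hypothesis fST : forall s, s \in S -> f s \in T.

Definition loc_map (z : loc S) : loc T :=
  frac (f (repr z).1) (fST (denP (repr z))).

Lemma loc_map_frac (a s : A) (sS : s \in S) :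
  loc_map (frac a sS) = frac (f a) (fST sS).
Proof.
have [u uS /= e] := loc_reprP (mkpair a sS).
apply/eq_frac; exists (f u); first exact: fST.
by rewrite /frac -!rmorphM e.
Qed.

Lemma loc_map_zmod : zmod_morphism loc_map.
Proof.
move=> x y; have [a [s [sS ->]]] := fracP x; have [b [t [tS ->]]] := fracP y.
rewrite fracN fracD !loc_map_frac fracN fracD.
apply/eq_frac; exists 1; first exact: rpred1.
by rewrite !(rmorphD, rmorphM, rmorphN).
Qed.

Lemma loc_map_monoid : monoid_morphism loc_map.
Proof.
split=> [|x y].
  rewrite -frac1 loc_map_frac -frac1; apply/eq_frac.
  by exists 1; [exact: rpred1 | rewrite !rmorph1].
have [a [s [sS ->]]] := fracP x; have [b [t [tS ->]]] := fracP y.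
rewrite fracM !loc_map_frac fracM.
by apply/eq_frac; exists 1; [exact: rpred1 | rewrite !rmorphM].
Qed.

HB.instance Definition _ :=
  GRing.isZmodMorphism.Build (loc S) (loc T) loc_map loc_map_zmod.
HB.instance Definition _ :=
  GRing.isMonoidMorphism.Build (loc S) (loc T) loc_map loc_map_monoid.

End LocMap.

Section PrimeComplement.
Variables (A : comPzRingType) (p : primeIdeal A).

Definition prime_compl : {pred A} := fun a => `[< ~ prime_set p a >].

Lemma prime_complP a : reflect (~ prime_set p a) (a \in prime_compl).
Proof. exact: asboolP. Qed.

Lemma prime_compl_mulr_closed : mulr_closed prime_compl.
Proof.
have [_ p1 pM] := prime_setP p.
split=> [|x y /prime_complP nx /prime_complP ny]; apply/prime_complP => //.
by move=> /pM[].
Qed.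

HB.instance Definition _ :=
  GRing.isMulClosed.Build A prime_compl prime_compl_mulr_closed.

(* A_p *)
Definition loc_at := loc prime_compl.
HB.instance Definition _ := GRing.ComPzRing.on loc_at.

Lemma loc_at_oner_neq0 : 1 != 0 :> loc_at.
Proof.
apply/eqP; rewrite -frac1 -frac0 => /eq_frac[u /prime_complP nu].
by rewrite mul0r mulr0 !mulr1 => u0; apply: nu; rewrite u0; case: (prime_setP p) => -[].
Qed.

HB.instance Definition _ :=
  GRing.PzSemiRing_isNonZero.Build loc_at loc_at_oner_neq0.

(* p A_p *)
Definition loc_max : {pred loc_at} :=
  fun z => `[< exists a s (sS : s \in prime_compl), prime_set p a /\ z = frac a sS >].

Lemma loc_max_fracP a s (sS : s \in prime_compl) :
  reflect (prime_set p a) ((frac a sS : loc_at) \in loc_max).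
Proof.
have [[p0 pD pMl] p1 pM] := prime_setP p.
apply: (iffP (asboolP _)) => [[b [t [tS [pb]]]]|pa]; last by exists a, s, sS.
move=> /eq_frac[u /prime_complP nu e]; move/prime_complP: (tS) => nt.
have : prime_set p (u * (a * t)) by rewrite e mulrA mulrAC; exact: pMl.
by move=> /pM[/nu//|/pM[//|/nt]].
Qed.

Lemma loc_max_idealr_closed : idealr_closed loc_max.
Proof.
have [[p0 pD pMl] p1 pM] := prime_setP p.
split.
- by rewrite -[0]frac0; apply/loc_max_fracP.
- by rewrite -[1]frac1; apply/loc_max_fracP.
- move=> z x y; have [a [s [sS ->]]] := fracP z.
  have [b [t [tS ->]]] := fracP x; have [c [r [rS ->]]] := fracP y.
  move=> /loc_max_fracP pb /loc_max_fracP pc.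
  rewrite [_ * _]fracM [_ + _]fracD; apply/loc_max_fracP.
  by apply: pD; rewrite mulrC; apply: (pMl) => //; exact: pMl.
Qed.

HB.instance Definition _ := isIdealr.Build loc_at loc_max loc_max_idealr_closed.

(* kappa(p) = A_p / p A_p *)
Definition residue_field := {ideal_quot loc_max}.
HB.instance Definition _ := GRing.ComNzRing.on residue_field.

End PrimeComplement.

Arguments loc_max {A} p z.

(* The homomorphism kappa(p) -> kappa(q) induced by f : A -> B when q lies
   over p. *)
Section ResidueMap.
Variables (A B : comPzRingType) (f : {rmorphism A -> B}).
Variables (p : primeIdeal A) (q : primeIdeal B).
Hypothesis q_over_p : f @^-1` q = p :> set A.

Lemma prime_compl_over a : a \in prime_compl p -> f a \in prime_compl q.
Proof. by move=> /prime_complP; rewrite -q_over_p => ?; apply/prime_complP. Qed.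

Definition loc_at_map : loc_at p -> loc_at q := loc_map prime_compl_over.
HB.instance Definition _ := GRing.RMorphism.on loc_at_map.

Definition residue_map (x : residue_field p) : residue_field q :=
  \pi_(residue_field q) (loc_at_map (repr x)).

Lemma residue_map_pi (z : loc_at p) :
  residue_map (\pi_(residue_field p) z) = \pi_(residue_field q) (loc_at_map z).
Proof.
apply/eqP; rewrite -Quotient.idealrBE -rmorphB.
have : repr (\pi_(residue_field p) z) - z \in loc_max p.
  by rewrite Quotient.idealrBE reprK.
move: (_ - z) => w; have [a [s [sS ->]]] := fracP w => /loc_max_fracP pa.
rewrite [X in X \in _]loc_map_frac.
by apply/loc_max_fracP; move: pa; rewrite -q_over_p.
Qed.

Lemma residue_map_zmod : zmod_morphism residue_map.
Proof.
elim/quotW=> x; elim/quotW=> y.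
by rewrite -rmorphB !residue_map_pi !rmorphB.
Qed.

Lemma residue_map_monoid : monoid_morphism residue_map.
Proof.
split; first by rewrite -(rmorph1 \pi_(residue_field p)) residue_map_pi !rmorph1.
elim/quotW=> x; elim/quotW=> y.
by rewrite -rmorphM !residue_map_pi !rmorphM.
Qed.

HB.instance Definition _ :=
  GRing.isZmodMorphism.Build _ _ residue_map residue_map_zmod.
HB.instance Definition _ :=
  GRing.isMonoidMorphism.Build _ _ residue_map residue_map_monoid.

End ResidueMap.

(* B_p = (A \ p)^-1 B, the localization of B at the image of A \ p. *)
Section LocalizationOver.
Variables (A B : comPzRingType) (f : {rmorphism A -> B}) (p : primeIdeal A).

Definition compl_image : {pred B} :=
  fun b => `[< exists2 s, s \in prime_compl p & f s = b >].

Lemma compl_image_mulr_closed : mulr_closed compl_image.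
Proof.
split=> [|_ _ /asboolP[s sS <-] /asboolP[t tS <-]]; apply/asboolP.
  by exists 1; rewrite ?rpred1 ?rmorph1.
by exists (s * t); rewrite ?rpredM ?rmorphM.
Qed.

HB.instance Definition _ :=
  GRing.isMulClosed.Build B compl_image compl_image_mulr_closed.

Lemma mem_compl_image s : s \in prime_compl p -> f s \in compl_image.
Proof. by move=> sS; apply/asboolP; exists s. Qed.

Definition loc_over := loc compl_image.
HB.instance Definition _ := GRing.ComPzRing.on loc_over.

Definition loc_over_map : loc_at p -> loc_over := loc_map mem_compl_image.
HB.instance Definition _ := GRing.RMorphism.on loc_over_map.

Definition to_loc_over : B -> loc_over := @to_loc B compl_image.
HB.instance Definition _ := GRing.RMorphism.on to_loc_over.

End LocalizationOver.

Section Extensions.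
Variables (A B : comPzRingType) (f : {rmorphism A -> B}).

(* b is a root of the monic polynomial X^n + a_(n-1) X^(n-1) + ... + a_0. *)
Definition integral_over (b : B) : Prop :=
  exists n (a : 'I_n -> A), b ^+ n + \sum_(i < n) f (a i) * b ^+ i = 0.

Definition integral_extension : Prop :=
  injective f /\ forall b, integral_over b.

(* A_B^F; the summand A_p stands for its image under A_p -> B_p. *)
Definition F_closure (F : spec_functor) : set B :=
  [set b | forall p : primeIdeal A, fspec F p ->
    exists (a : loc_at p) (r : loc_over f p),
      jacobson (loc_over f p) r /\ to_loc_over f p b = loc_over_map f a + r].

Lemma F_closure_subring F : is_subring (F_closure F).
Proof.
split=> [p _|x y hx hy p Fp|x y hx hy p Fp].
- exists 1, 0; split; last by rewrite addr0 [LHS]rmorph1 [RHS]rmorph1.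
  by case: (jacobson_ideal (loc_over f p)).
- have [a [r [Jr e]]] := hx p Fp; have [b [s [Js e']]] := hy p Fp.
  exists (a - b), (r - s); split; first exact: ideal_sub (jacobson_ideal _) _ _.
  have -> : to_loc_over f p (x - y) = to_loc_over f p x - to_loc_over f p y.
    exact: rmorphB.
  have -> : loc_over_map f (a - b) = loc_over_map f a - loc_over_map f b.
    exact: rmorphB.
  by rewrite e e' opprD addrACA.
- have [a [r [Jr e]]] := hx p Fp; have [b [s [Js e']]] := hy p Fp.
  have [_ JD JM] := jacobson_ideal (loc_over f p).
  exists (a * b), (loc_over_map f a * s + (loc_over_map f b + s) * r).
  split; first by apply: JD; apply: JM.
  have -> : to_loc_over f p (x * y) = to_loc_over f p x * to_loc_over f p y.
    exact: rmorphM.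
  have -> : loc_over_map f (a * b) = loc_over_map f a * loc_over_map f b.
    exact: rmorphM.
  by rewrite e e'; ring.
Qed.

Definition F_subintegral (F : spec_functor) : Prop :=
  integral_extension /\
  forall p : primeIdeal A, fspec F p ->
    (exists! q : primeIdeal B, f @^-1` q = p :> set A) /\
    forall (q : primeIdeal B) (q_over_p : f @^-1` q = p :> set A),
      fspec F q /\ bijective (residue_map q_over_p).

End Extensions.

(* Main.v *)
Require Import Defs.
From mathcomp Require Import all_boot all_order all_algebra.
From mathcomp Require Import boolp classical_sets.
From mathcomp Require Import generic_quotient ring_quotient ring.

Set Implicit Arguments.
Unset Strict Implicit.
Unset Printing Implicit Defensive.

Import Defs GRing.Theory.
Local Open Scope ring_scope.
Local Open Scope quotient_scope.
Local Open Scope classical_set_scope.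

(** Everything takes place among the primes of A, C and B lying over a fixed
p in F(A); what a fraction field or a Jacobson radical has to do with them is
expressed by numerators and denominators.

On the side of B: an ideal of B_p is maximal exactly when its contraction is
an ideal Q of B maximal among those missing the image of A \ p, and, the
extension being integral, such Q are exactly the primes of B over p.  Hence
Rad(B_p) consists of the fractions whose numerator lies in all these primes,
and an element b of B belongs to A_B^F iff for every p in F(A) there are a, s in
A, s outside p, with s b - a in every prime of B over p ([F_closureP]).

On the side of C: kappa(p) -> kappa(q) is bijective iff for every c in C there
are a, s in A, s outside p, with s c - a in q ([residue_map_bijP]).

If A -> C is F-subintegral, every prime of B over p contracts to the unique q
over p, so the pair (a, s) that q provides for c works for all of them.
Conversely, if C lies in A_B^F, then by lying over for C -> B one pair (a, s)
works for c at all primes q of C over p simultaneously.  Whether c belongs to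
q is then decided by whether a belongs to p, so q is unique; its residue
extension is trivial; and F-membership passes from p to q, for real primes
because a sum of squares in q becomes, after multiplication by a common s^2,
a sum of squares of elements of A modulo q ([real_over]).

The facts on integral extensions (lying over, maximality of the primes over a
maximal ideal, and the description of the maximal ideals of B_p) all come from
[maximal_avoiding_preimage]: being maximal among the ideals that miss a
multiplicative set S descends and ascends along an integral map.  This
property can be followed through A -> C -> B one step at a time, so
transitivity of integrality, and with it the determinant trick, is avoided. *)

(** * Ideals maximal among those missing a multiplicative set *)

Definition multiplicative (R : comPzRingType) (S : set R) : Prop :=
  S 1 /\ forall x y, S x -> S y -> S (x * y).

(** Maximality among the ideals disjoint from [S] is put as comaximality (every
larger ideal [N + (b)] meets [S]) because a relation [s = b y] modulo [N] can
be carried along a ring map.  The case [S = {1}] is that of the maximal ideals,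
and the complement of a prime [p] has only [p]. *)
Definition maximal_avoiding (R : comPzRingType) (S N : set R) : Prop :=
  [/\ ideal N, forall s, S s -> ~ N s
    & forall b, ~ N b -> exists s y, S s /\ N (s - b * y)].

Section MaximalAvoiding.
Variable R : comPzRingType.
Implicit Types (S N I : set R) (p : primeIdeal R).

Lemma multiplicativeX S s n : multiplicative S -> S s -> S (s ^+ n).
Proof.
by move=> [S1 SM] Ss; elim: n => [|n IHn]; rewrite ?expr0 // exprS; exact: SM.
Qed.

Lemma multiplicative1 : multiplicative [set 1 : R].
Proof. by split=> // x y -> ->; rewrite mulr1. Qed.

Lemma multiplicative_compl p : multiplicative (~` p).
Proof. by case: (prime_setP p) => _ p1 pM; split=> // x y nx ny /pM[]. Qed.

(** If neither [x] nor [y] is in [N], then [s = x u] and [t = y v] modulo [N]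
for some [s], [t] in [S]; were [x y] in [N], so would be [s t], an element of
[S]. *)
Lemma maximal_avoiding_prime S N :
  multiplicative S -> maximal_avoiding S N -> prime_ideal N.
Proof.
move=> [S1 SM] [idN NS Nmax]; have [N0 ND NM] := idN.
split=> // [|x y Nxy]; first exact: NS.
apply: contrapT => /not_orP[/Nmax[s [u [Ss Nu]]] /Nmax[t [v [St Nv]]]].
apply: (NS _ (SM _ _ Ss St)).
have -> : s * t = t * (s - x * u) + (x * u * (t - y * v) + u * v * (x * y)).
  by ring.
by apply: (ND); [|apply: (ND)]; apply: NM.
Qed.

Definition ideal_adjoin N b : set R := [set z | exists n y, N n /\ z = n + b * y].

Lemma ideal_adjoinP N b : ideal N ->
  [/\ ideal (ideal_adjoin N b), N `<=` ideal_adjoin N b & ideal_adjoin N b b].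
Proof.
move=> [N0 ND NM]; split.
- split; first by exists 0, 0; rewrite mulr0 addr0.
    move=> _ _ [n [y [Nn ->]]] [m [z [Nm ->]]]; exists (n + m), (y + z).
    by split; [exact: ND|ring].
  move=> c _ [n [y [Nn ->]]]; exists (c * n), (c * y).
  by split; [exact: NM|ring].
- by move=> n Nn; exists n, 0; rewrite mulr0 addr0.
- by exists 0, 1; rewrite mulr1 add0r.
Qed.

Lemma maximal_avoiding1 N : maximal_avoiding [set 1] N <-> maximal_ideal N.
Proof.
split=> [[idN N1 Nmax]|[idN N1 Nmax]].
  split=> // [|J [J0 JD JM] NJ J1]; first exact: N1.
  apply/seteqP; split=> // b Jb; apply: contrapT => /Nmax[_ [y [-> Ny]]].
  apply: J1; rewrite -[1](subrK (b * y)).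
  by apply: JD; [exact: NJ|rewrite mulrC; exact: JM].
split=> // [_ ->//|b Nb].
have [idJ NJ Jb] := ideal_adjoinP b idN.
case: (pselect (ideal_adjoin N b 1)) => [[n [y [Nn ->]]]|J1].
  by exists (n + b * y), y; split; rewrite ?addrK.
by case: Nb; rewrite -(Nmax _ idJ).
Qed.

Lemma maximal_avoiding_compl p N : maximal_avoiding (~` p) N <-> N = p :> set R.
Proof.
have [idp p1 pM] := prime_setP p; split=> [[idN Np Nmax]|->].
  have Nsub : N `<=` p by move=> x Nx; apply: contrapT => /Np.
  apply/seteqP; split=> // x px; apply: contrapT => /Nmax[s [y [ps /Nsub]]] psy.
  apply: ps; case: (idp) => _ pD pMl; rewrite -[s](subrK (x * y)).
  by apply: pD => //; rewrite mulrC; exact: pMl.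
by split=> // b pb; exists b, 1; rewrite mulr1 subrr; split=> //; case: idp.
Qed.

(** Zorn's lemma.  The union of the empty chain is the empty set, which is no
ideal, so it is added to the sets under consideration; a maximal one cannot be
empty since [I] is larger. *)
Lemma maximal_avoiding_exists S I : ideal I -> (forall s, S s -> ~ I s) ->
  exists N, maximal_avoiding S N /\ I `<=` N.
Proof.
move=> idI IS.
pose admissible X := [/\ ideal X, I `<=` X & forall s, S s -> ~ X s].
have [F FP Ftot|N [PN Nmax]] := @Zorn_bigcup R [set X | X = set0 \/ admissible X].
  have [[X FX [x Xx]]|F0] := pselect (exists2 X, F X & X !=set0); last first.
    left; apply/seteqP; split=> // x [X FX Xx].
    by apply: F0; exists X => //; exists x.
  have admF Y y : F Y -> Y y -> admissible Y.
    by move=> /FP[->//|].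
  right; have [[X0 _ _] IX _] := admF _ _ FX Xx; split.
  - split; first by exists X.
      move=> y z [Y FY Yy] [Z FZ Zz]; case: (Ftot _ _ FY FZ) => YZ.
        by exists Z => //; case: (admF _ _ FZ Zz) => -[_ ZD _] _ _; apply/ZD/Zz/YZ.
      by exists Y => //; case: (admF _ _ FY Yy) => -[_ YD _] _ _; apply/YD/YZ.
    move=> a y [Y FY Yy]; exists Y => //.
    by case: (admF _ _ FY Yy) => -[_ _ YM] _ _; apply: YM.
  - by move=> y /IX Xy; exists X.
  - by move=> s Ss [Y FY Ys]; case: (admF _ _ FY Ys) => _ _ /(_ s Ss).
have [N0|{PN} [idN IN NS]] := PN.
  case: (Nmax I); last by right; split.
  by rewrite N0; split=> // /(_ 0); apply; case: idI.
exists N; split=> //; split=> // b Nb.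
have [idJ NJ Jb] := ideal_adjoinP b idN.
apply: contrapT => Sb; apply: (Nmax (ideal_adjoin N b)).
  by split=> // /(_ b Jb).
right; split=> // [i /IN/NJ //|].
move=> s Ss [n [y [Nn e]]]; apply: Sb; exists s, y; split=> //.
by rewrite e addrK.
Qed.

End MaximalAvoiding.

Lemma preimage_ideal (R R' : comPzRingType) (g : {rmorphism R -> R'}) (I : set R') :
  ideal I -> ideal (g @^-1` I).
Proof.
move=> [I0 ID IM]; split; rewrite /preimage /=.
- by rewrite rmorph0.
- by move=> x y /= Ix Iy; rewrite rmorphD; exact: ID.
- by move=> a x /= Ix; rewrite rmorphM; exact: IM.
Qed.

Lemma preimage_prime (R R' : comPzRingType) (g : {rmorphism R -> R'}) (I : set R') :
  prime_ideal I -> prime_ideal (g @^-1` I).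
Proof.
move=> [idI I1 IM]; split; first exact: preimage_ideal.
  by rewrite /preimage /= rmorph1.
by move=> x y; rewrite /preimage /= rmorphM; exact: IM.
Qed.

Definition preimage_primeIdeal (R R' : comPzRingType) (g : {rmorphism R -> R'})
    (Q : primeIdeal R') : primeIdeal R :=
  PrimeIdeal (preimage_prime g (prime_setP Q)).

Lemma primeIdeal_inj (R : comPzRingType) (p q : primeIdeal R) :
  p = q :> set R -> p = q.
Proof.
case: p q => [p pP] [q qP] /= e; rewrite e in pP *.
by congr PrimeIdeal; exact: Prop_irrelevance.
Qed.

(** * Primes in an integral extension *)

Section Integral.
Variables (R R' : comPzRingType) (g : {rmorphism R -> R'}).
Hypothesis g_int : forall b, integral_over g b.

(** Multiply the equation of degree [n] of [b] by [x ^+ n]: it becomes an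
equation of [x b] over the ideal [(x)], and modulo [I] the element [x b] can
be replaced by [s].  So a relation [s = x b] modulo [I] with [b] upstairs
yields one between a power of [s] and a multiple of [x] downstairs. *)
Lemma integral_clear_denominator (I : set R') (s x : R) (b : R') :
  ideal I -> I (g s - g x * b) -> exists n y, I (g (s ^+ n + x * y)).
Proof.
move=> [I0 ID IM] Is; have [n [a eb]] := g_int b.
exists n, (\sum_(i < n) a i * x ^+ (n - i).-1 * s ^+ i).
have subX i : I (g s ^+ i - (g x * b) ^+ i).
  by rewrite subrXX mulrC; exact: IM.
(* The terms in [g x * b] on the right add up to zero: they are the equation of
   [b] multiplied by [g x ^+ n]. *)
suff e : g (s ^+ n + x * \sum_(i < n) a i * x ^+ (n - i).-1 * s ^+ i)
    = (g s ^+ n - (g x * b) ^+ n)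
      + \sum_(i < n) g (a i * x ^+ (n - i)) * (g s ^+ i - (g x * b) ^+ i).
  rewrite e; apply: (ID) => //.
  by apply: (big_ind I) => [//|y z|i _]; [exact: ID|exact: IM].
have -> : (g x * b) ^+ n = - \sum_(i < n) g (a i * x ^+ (n - i)) * (g x * b) ^+ i.
  rewrite exprMn; move/eqP: eb; rewrite addr_eq0 => /eqP ->.
  rewrite mulrN mulr_sumr; congr (- _); apply: eq_bigr => i _.
  have -> : g x ^+ n = g x ^+ (n - i) * g x ^+ i by rewrite -exprD subnK // ltnW.
  by rewrite exprMn rmorphM rmorphXn; ring.
rewrite opprK -addrA -big_split /= rmorphD rmorphXn; congr (_ + _).
rewrite mulr_sumr rmorph_sum; apply: eq_bigr => i _.
rewrite mulrBr addrC subrK !rmorphM !rmorphXn.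
have -> : g x ^+ (n - i) = g x * g x ^+ (n - i).-1.
  by rewrite -exprS prednK // subn_gt0.
by ring.
Qed.

(** A non-zero element of the domain [R' / Q] has a non-zero multiple in the
image of [R], namely the constant term of an equation of minimal degree: a
zero constant term would allow dividing by [b]. *)
Lemma integral_multiple_mem_image (Q : set R') (b : R') : prime_ideal Q -> ~ Q b ->
  exists c y, ~ Q (g c) /\ Q (g c - b * y).
Proof.
move=> [[Q0 QD QM] Q1 Qpr] Qb; have [n [a]] := g_int b.
suff H : Q (b ^+ n + \sum_(i < n) g (a i) * b ^+ i) ->
    exists c y, ~ Q (g c) /\ Q (g c - b * y) by move=> e; apply: H; rewrite e.
elim: n a => [|n IHn] a; first by rewrite big_ord0 addr0.
rewrite big_ord_recl expr0 mulr1.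
set y := b ^+ n + \sum_(i < n) g (a (lift ord0 i)) * b ^+ i.
have -> : b ^+ n.+1 + (g (a ord0) + \sum_(i < n) g (a (lift ord0 i)) * b ^+ lift ord0 i)
    = g (a ord0) - b * - y.
  rewrite mulrN opprK addrCA; congr (_ + _).
  rewrite mulrDr exprS mulr_sumr; congr (_ + _); apply: eq_bigr => i _.
  by rewrite exprS mulrCA.
case: (pselect (Q (g (a ord0)))) => [Qa Qy|Qa Qy]; last by exists (a ord0), (- y).
apply: (IHn (fun i => a (lift ord0 i))); case: (Qpr b y) => //.
rewrite -[b * y](addKr (g (a ord0))) addrC.
by apply: QD; [rewrite mulrN opprK in Qy|rewrite -mulN1r; exact: QM].
Qed.

(** Downwards, a relation [s = x b] modulo [Q] is pushed down by
[integral_clear_denominator].  Upwards, [b] outside [Q] divides modulo [Q] some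
[g c] with [c] outside the preimage of [Q], and [c] in turn divides an element of
[S].  With [S] the complement of a prime [p] this says that the primes over [p]
are exactly the ideals maximal among those missing the image of [S]. *)
Lemma maximal_avoiding_preimage (S : set R) (Q : set R') :
    multiplicative S -> prime_ideal Q ->
  maximal_avoiding (g @` S) Q <-> maximal_avoiding S (g @^-1` Q).
Proof.
move=> mS primeQ; have [idQ Q1 Qpr] := primeQ; have [Q0 QD QM] := idQ.
split=> [[_ QS Qmax]|[_ QS Qmax]].
  split=> [|s Ss|x Qx]; first exact: preimage_ideal.
    by apply: QS; exists s.
  have [_ [b [[s Ss <-] /(integral_clear_denominator idQ)[n [y Qy]]]]] := Qmax _ Qx.
  exists (s ^+ n), (- y); rewrite mulrN opprK; split=> //.
  exact: multiplicativeX.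
split=> // [_ [s Ss <-]|b Qb]; first exact: QS.
have [c [y [Qc Qy]]] := integral_multiple_mem_image primeQ Qb.
have [s [z [Ss Qz]]] := Qmax _ Qc.
exists (g s), (y * g z); split; first by exists s.
have -> : g s - b * (y * g z) = g (s - c * z) + g z * (g c - b * y).
  by rewrite rmorphB rmorphM; ring.
by apply: QD => //; exact: QM.
Qed.

Lemma multiplicative_image (S : set R) : multiplicative S -> multiplicative (g @` S).
Proof.
move=> [S1 SM]; split; first by exists 1; rewrite ?rmorph1.
by move=> _ _ [x Sx <-] [y Sy <-]; exists (x * y); rewrite ?rmorphM //; exact: SM.
Qed.

(** The case [S = {1}] of [maximal_avoiding_preimage]. *)
Lemma maximal_preimage (Q : set R') :
  prime_ideal Q -> maximal_ideal (g @^-1` Q) -> maximal_ideal Q.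
Proof.
move=> primeQ /maximal_avoiding1; rewrite -(maximal_avoiding_preimage _ primeQ).
  by rewrite image_set1 rmorph1 => /maximal_avoiding1.
exact: multiplicative1.
Qed.

(** A prime over [p] is any ideal maximal among those missing the image of the
complement of [p]; injectivity ensures that the zero ideal misses it. *)
Lemma lying_over (p : primeIdeal R) : injective g ->
  exists Q : primeIdeal R', g @^-1` Q = p :> set R.
Proof.
move=> g_inj; have [p0 p1 _] := prime_setP p.
have [|_ [s ps <-]|N [Nmax _]] := @maximal_avoiding_exists _ (g @` ~` p) [set 0].
- by split=> [//|x y -> ->|a x ->]; rewrite ?addr0 ?mulr0.
- by move=> /= gs; apply: ps; rewrite (g_inj s 0) ?rmorph0 //; case: p0.
have primeN : prime_ideal N.
  apply: maximal_avoiding_prime Nmax.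
  exact/multiplicative_image/multiplicative_compl.
exists (PrimeIdeal primeN); apply/maximal_avoiding_compl.
by apply/maximal_avoiding_preimage => //; exact: multiplicative_compl.
Qed.

End Integral.

(** * The Jacobson radical of a localization *)

Section MaximalIdealsOfLocalization.
Variables (R : comPzRingType) (S : mulrClosed R).
Implicit Types (M : set (loc S)) (N : set R).

Lemma frac_mem M (b s : R) (sS : s \in S) : ideal M ->
  M (frac b sS) <-> M (to_loc S b).
Proof.
move=> [_ _ MM]; split=> h.
  have -> : to_loc S b = to_loc S s * frac b sS; last exact: MM.
  by rewrite fracM; apply/eq_frac; exists 1; [exact: rpred1|ring].
have -> : frac b sS = frac 1 sS * to_loc S b; last exact: MM.
by rewrite fracM; apply/eq_frac; exists 1; [exact: rpred1|ring].
Qed.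

Lemma maximal_avoiding_contraction M :
  maximal_ideal M -> maximal_avoiding [set` S] (to_loc S @^-1` M).
Proof.
move=> /maximal_avoiding1[idM M1 Mmax]; have [M0 MD MM] := idM.
split=> [|s /= sS Ms|b Mb]; first exact: preimage_ideal.
  apply: (M1 1) => //; have -> : 1 = frac s sS; last by apply/frac_mem.
  by rewrite -frac1; apply/eq_frac; exists 1; [exact: rpred1|ring].
have [_ [z [-> ]]] := Mmax _ Mb; have [y [s [sS ->]]] := fracP z.
rewrite -frac1 fracM fracN fracD => /(frac_mem _ _ idM) h.
by exists s, y; split=> //; move: h; rewrite !mul1r !mulr1.
Qed.

(** The witness is the extension of [N], that is the set of fractions with a
numerator in [N]; [N] being prime and disjoint from [S], all numerators of
such a fraction lie in [N]. *)
Lemma maximal_avoiding_extension N : maximal_avoiding [set` S] N ->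
  exists2 M, maximal_ideal M & to_loc S @^-1` M `<=` N.
Proof.
move=> Nmax; have [idN NS Ncom] := Nmax; have [N0 ND NM] := idN.
have [_ _ Npr] : prime_ideal N.
  by apply: maximal_avoiding_prime Nmax; split=> [|x y]; [exact: rpred1|exact: rpredM].
pose M := [set z : loc S | exists b s (sS : s \in S), N b /\ z = frac b sS].
have MN b s (sS : s \in S) : M (frac b sS) -> N b.
  move=> [c [t [tS [Nc /eq_frac[u uS e]]]]].
  have : N (u * (b * t)) by rewrite e mulrA mulrAC; exact: NM.
  by move=> /Npr[/(NS _ uS)//|/Npr[//|/(NS _ tS)]].
exists M; last by move=> b /MN.
apply/maximal_avoiding1; split.
- split; first by exists 0, 1, (rpred1 S); rewrite frac0.
    move=> _ _ [b [s [sS [Nb ->]]]] [c [t [tS [Nc ->]]]].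
    exists (b * t + c * s), (s * t), (rpredM sS tS); rewrite fracD; split=> //.
    by apply: ND; rewrite mulrC; exact: NM.
  move=> z _ [b [s [sS [Nb ->]]]]; have [a [t [tS ->]]] := fracP z.
  by exists (a * b), (t * s), (rpredM tS sS); rewrite fracM; split=> //; exact: NM.
- move=> _ -> ; rewrite -frac1 => /MN; exact: (NS _ (rpred1 S)).
- move=> z; have [b [s [sS ->]]] := fracP z => Mb.
  have [t [y [tS Ny]]] : exists t y, [set` S] t /\ N (t - b * y).
    by apply: Ncom => Nb; apply: Mb; exists b, s, sS.
  exists 1, (frac (s * y) tS); split=> //.
  exists (t - b * y), t, tS; split=> //.
  rewrite -frac1 fracM fracN fracD; apply/eq_frac; exists 1; first exact: rpred1.
  by ring.
Qed.

Lemma jacobson_frac (b s : R) (sS : s \in S) :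
  jacobson (loc S) (frac b sS) <-> forall N, maximal_avoiding [set` S] N -> N b.
Proof.
split=> [Jb N /maximal_avoiding_extension[M maxM]|Nb M maxM].
  have [idM _ _] := maxM; move=> MN; apply: MN => /=.
  apply/(frac_mem b sS idM); exact: Jb.
have [idM _ _] := maxM; apply/frac_mem => //.
exact: (Nb _ (maximal_avoiding_contraction maxM)).
Qed.

End MaximalIdealsOfLocalization.

(** * Trivial residue field extensions *)

Section Fractions.
Variables (A B : comPzRingType) (f : {rmorphism A -> B}).

(** The condition says that the elements [b / 1] of the residue field of [q] are
in the image.  That is enough for surjectivity: the image is a field, and an
element with a non-zero value in the residue field of [q] comes from one that
is non-zero in that of [p].  Injectivity is automatic. *)
Lemma residue_map_bijP (p : primeIdeal A) (q : primeIdeal B)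
    (q_over_p : f @^-1` q = p :> set A) :
  bijective (residue_map q_over_p) <->
  forall b, exists a s, ~ prime_set p s /\ prime_set q (f s * b - f a).
Proof.
have [[q0 qD qM] q1 qpr] := prime_setP q.
split=> [[h _ hK] b|H].
  set y := \pi_(residue_field q) (to_loc (prime_compl q) b : loc_at q).
  move: (hK y); elim/quotW: (h y) => z; have [a [s [sS ->]]] := fracP z.
  rewrite residue_map_pi => /esym/eqP; rewrite -Quotient.idealrBE.
  rewrite [loc_at_map _ _]loc_map_frac [- _]fracN [X in X \in _]fracD.
  move=> /loc_max_fracP qab.
  exists a, s; split; first exact/prime_complP.
  by move: qab; rewrite mulr1 mulrC.
have inj : injective (residue_map q_over_p).
  elim/quotW=> x; elim/quotW=> y; rewrite !residue_map_pi => /eqP.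
  rewrite -Quotient.idealrBE -rmorphB => h; apply/eqP; rewrite -Quotient.idealrBE.
  move: (x - y) h => z /=; have [a [s [sS ->]]] := fracP z.
  rewrite [loc_at_map _ _]loc_map_frac => /loc_max_fracP qa.
  by apply/loc_max_fracP; rewrite -q_over_p.
have surj y : exists x, residue_map q_over_p x = y.
  elim/quotW: y => z; have [c [t [tS ->]]] := fracP z.
  have [a [s [ps qs]]] := H c; have [b [u [pu qu]]] := H t.
  (* [c] is [a / s] and [t] is [b / u] modulo [q], so [c / t] is the image of
     [a u / (s b)] provided that [b] is not in [p]. *)
  have pb : ~ prime_set p b.
    rewrite -q_over_p /= => qb; have : prime_set q (f u * t).
      by rewrite -[f u * t](subrK (f b)); exact: qD.
    case/qpr => [|/(prime_complP _ _ tS)//].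
    by rewrite -[prime_set q _]/((f @^-1` q) u) q_over_p.
  have sbS : s * b \in prime_compl p.
    by rewrite rpredM //; exact/prime_complP.
  exists (\pi_(residue_field p) (frac (a * u) sbS : loc_at p)).
  rewrite residue_map_pi [loc_at_map _ _]loc_map_frac.
  apply/eqP; rewrite -Quotient.idealrBE [- _]fracN [X in X \in _]fracD.
  apply/loc_max_fracP; rewrite !rmorphM.
  have -> : f a * f u * t + - c * (f s * f b)
      = f a * (f u * t - f b) + - f b * (f s * c - f a) by ring.
  by apply: qD; exact: qM.
have [h hK] := choice surj.
by exists h => // x; apply: inj.
Qed.

End Fractions.

(** * The F-closure in terms of the primes over p *)

Section Tower.
Variables (A C B : comPzRingType) (f : {rmorphism A -> C}) (g : {rmorphism C -> B}).
Hypotheses (f_int : forall c, integral_over f c) (g_int : forall b, integral_over g b).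

(** Both maps are integral, so maximality among the ideals missing the image of
[A \ p] is pulled back in two steps to [A], where it characterizes [p]. *)
Lemma over_tower (p : primeIdeal A) (Q : set B) :
  maximal_avoiding [set` compl_image (g \o f) p] Q <->
  prime_ideal Q /\ (g \o f) @^-1` Q = p.
Proof.
have mp := multiplicative_compl p.
have mfp : multiplicative (f @` ~` p) by exact: multiplicative_image.
have -> : [set` compl_image (g \o f) p] = g @` (f @` ~` p).
  apply/seteqP; split=> b.
    by move=> /= /asboolP[s /prime_complP ps <-]; exists (f s) => //; exists s.
  by move=> [_ [s ps <-] <-] /=; apply/asboolP; exists s => //; exact/prime_complP.
have over : prime_ideal Q ->
    maximal_avoiding (g @` (f @` ~` p)) Q <-> (g \o f) @^-1` Q = p.
  move=> primeQ; rewrite (maximal_avoiding_preimage g_int) //.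
  rewrite (maximal_avoiding_preimage f_int) //; last exact: preimage_prime.
  exact: maximal_avoiding_compl.
split=> [maxQ|[primeQ /over]]; last exact.
have primeQ : prime_ideal Q.
  by apply: maximal_avoiding_prime maxQ; exact: multiplicative_image.
by split=> //; exact/over.
Qed.

(** The radical of [B_p] consists of the fractions whose numerator lies in all
primes over [p], and [s b - a] is a numerator of [b - a / s]. *)
Lemma F_closureP F b : F_closure (g \o f) F b <->
  forall p : primeIdeal A, fspec F p -> exists a s, ~ prime_set p s /\
    forall Q : primeIdeal B, (g \o f) @^-1` Q = p :> set A ->
      prime_set Q (g (f s) * b - g (f a)).
Proof.
have jacP (p : primeIdeal A) a s (sS : s \in prime_compl p) :
    jacobson (loc_over (g \o f) p)
      (to_loc_over (g \o f) p b - loc_over_map (g \o f) (frac a sS)) <->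
    forall Q : primeIdeal B, (g \o f) @^-1` Q = p :> set A ->
      prime_set Q (g (f s) * b - g (f a)).
  rewrite [loc_over_map _ _]loc_map_frac [- _]fracN [X in jacobson _ X]fracD.
  rewrite [b * _]mulrC mulr1.
  split=> [/jacobson_frac J Q Qp|H].
    by apply: J; apply/over_tower; split=> //; exact: prime_setP.
  by apply/jacobson_frac => N /over_tower[primeN]; exact: (H (PrimeIdeal primeN)).
split=> H p /H.
  move=> [z [r [Jr e]]]; have [a [s [sS ez]]] := fracP z.
  exists a, s; split; first exact/prime_complP.
  by apply/(jacP p a s sS); rewrite -ez e addrC addKr.
move=> [a [s [/prime_complP sS Qs]]].
exists (frac a sS), (to_loc_over (g \o f) p b - loc_over_map (g \o f) (frac a sS)).
by split; [exact/jacP|rewrite addrC subrK].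
Qed.

End Tower.

(** * Ascent of the F-spectrum *)

Section FSpec.
Variables (A C : comPzRingType) (f : {rmorphism A -> C}).
Hypothesis f_int : forall c, integral_over f c.
Variables (p : primeIdeal A) (q : primeIdeal C).
Hypothesis q_over_p : f @^-1` q = p :> set A.
Hypothesis residue_surj :
  forall c, exists a s, ~ prime_set p s /\ prime_set q (f s * c - f a).

(** With one denominator [s] for all terms, [s c_i] is congruent modulo [q] to
an element [a_i] of [A], so a sum of squares [c_i ^+ 2] in [q] gives a sum of
squares [a_i ^+ 2] in [p].  Hence the [a_i] are in [p] and the [c_i] in [q]. *)
Lemma real_over : real_ideal p -> real_ideal q.
Proof.
have [idq q1 qpr] := prime_setP q; have [q0 qD qM] := idq.
have pE a : prime_set p a <-> prime_set q (f a) by rewrite -q_over_p.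
move=> [_ real_p]; split=> // cs.
have [s [num_of [ps qs]]] : exists s (n : C -> A), ~ prime_set p s /\
    forall c, c \in cs -> prime_set q (f s * c - f (n c)).
  elim: cs => [|c cs [s [n [ps IHn]]]].
    by exists 1, (fun=> 0); case: (prime_setP p).
  have [a [t [pt qt]]] := residue_surj c.
  exists (s * t), (fun d => if d == c then s * a else t * n d).
  split; first exact: (multiplicative_compl p).2.
  move=> d; rewrite inE; case: eqP => [-> _|_ /= /IHn qd]; rewrite !rmorphM.
    by rewrite -mulrA -mulrBr; exact: qM.
  by rewrite mulrAC -[_ * _ * f t]mulrC -mulrBr; exact: qM.
move=> qsum c c_cs.
suff : prime_set p (num_of c).
  move/pE => qa; have : prime_set q (f s * c).
    by rewrite -[f s * c](subrK (f (num_of c))); apply: qD => //; exact: qs.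
  by case/qpr => [/pE|].
apply: (real_p (map num_of cs)); last exact: map_f.
apply/pE; rewrite big_map rmorph_sum.
have -> : \sum_(d <- cs) f (num_of d ^+ 2) =
   f s ^+ 2 * (\sum_(d <- cs) d ^+ 2)
   + \sum_(d <- cs) - (f s * d + f (num_of d)) * (f s * d - f (num_of d)).
  by rewrite mulr_sumr -big_split; apply: eq_bigr => d _; rewrite rmorphXn /=; ring.
apply: (qD); first exact: qM.
rewrite big_seq; apply: (big_ind (prime_set q)) => [//|x y|d d_cs]; first exact: qD.
exact/qM/qs.
Qed.

Lemma fspec_over F : fspec F p -> fspec F q.
Proof.
have max : maximal_ideal p -> maximal_ideal q.
  by rewrite -q_over_p; apply: maximal_preimage => //; exact: prime_setP.
case: F => /=; [by []|exact: max|by move=> [/real_over ? /max]|exact: real_over].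
Qed.

End FSpec.

Theorem proposition1p4 (F : spec_functor) (A C B : comPzRingType)
    (f : {rmorphism A -> C}) (g : {rmorphism C -> B})
    (AC : integral_extension f) (CB : integral_extension g) :
  F_subintegral f F <-> subring_of (range g) (F_closure (g \o f) F).
Proof.
have [f_inj f_int] := AC; have [g_inj g_int] := CB.
split=> [[_ sub]|[_ sub]].
  split.
    split; first by exists 1; rewrite ?rmorph1.
      by move=> _ _ [x _ <-] [y _ <-]; exists (x - y); rewrite ?rmorphB.
    by move=> _ _ [x _ <-] [y _ <-]; exists (x * y); rewrite ?rmorphM.
  move=> _ [c _ <-]; apply/F_closureP => // p /sub[[q [q_over q_uniq]] Hq].
  have [_ /residue_map_bijP/(_ c)[a [s [ps qs]]]] := Hq q q_over.
  exists a, s; split=> // Q Q_over; move: qs.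
  rewrite (q_uniq (preimage_primeIdeal g Q)) //.
  by rewrite /= /preimage /= rmorphB rmorphM.
(* Lying over for [C -> B] turns primes of [B] over [p] into primes of [C]; the
   pair [a], [s] depends on [c] only, and not on [q]. *)
have common p c : fspec F p -> exists a s, ~ prime_set p s /\
    forall q : primeIdeal C, f @^-1` q = p :> set A -> prime_set q (f s * c - f a).
  move=> Fp; have /F_closureP-/(_ f_int g_int p Fp) [a [s [ps Qs]]] :
    F_closure (g \o f) F (g c) by apply: sub; exists c.
  exists a, s; split=> // q q_over; have [Q Q_over] := lying_over g_int q g_inj.
  rewrite -Q_over /preimage /= rmorphB rmorphM; apply: Qs.
  by rewrite -[LHS]/(f @^-1` (g @^-1` Q)) Q_over.
split=> // p Fp; split; last first.
  move=> q q_over.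
  have surj c : exists a s, ~ prime_set p s /\ prime_set q (f s * c - f a).
    by have [a [s [ps qs]]] := common p c Fp; exists a, s; split=> //; exact: qs.
  by split; [exact: fspec_over q_over surj _ Fp|exact/residue_map_bijP].
have [q q_over] := lying_over f_int p f_inj.
exists q; split=> // q' q'_over; apply: primeIdeal_inj.
(* If [c] is in [q1], then [f a] is in [q1], so [a] is in [p] and [f a] in [q2]. *)
have le (q1 q2 : primeIdeal C) : f @^-1` q1 = p :> set A -> f @^-1` q2 = p :> set A ->
    q1 `<=` q2.
  move=> over1 over2 c q1c; have [a [s [ps qs]]] := common p c Fp.
  have [[_ D1 M1] _ _] := prime_setP q1; have [[_ D2 _] _ pr2] := prime_setP q2.
  have q2a : prime_set q2 (f a).
    rewrite -[prime_set q2 _]/((f @^-1` q2) a) over2 -over1 /=.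
    have -> : f a = f s * c + -1 * (f s * c - f a) by ring.
    by apply: D1; apply: M1 => //; exact: qs.
  have : prime_set q2 (f s * c).
    by rewrite -[f s * c](subrK (f a)); apply: D2 => //; exact: qs.
  by case/pr2 => //; rewrite -[prime_set q2 _]/((f @^-1` q2) s) over2.
by apply/seteqP; split; exact: le.
Qed.
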